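(* If $(X,\|\cdot\|)$ is a Banach space, then $E(X,\|\cdot\|)=L(X,\|\cdot\|)$ (as elements of $[1,\infty]$).
   Context: Spaces are assumed to have at least two points. The Banach space carries the metric $d(x,y)=\|x-y\|$. Balls are closed: $B^{cl}(x,r)=\{y\in X:\|x-y\|\le r\}$, $r>0$. A ball is understood to come with a chosen center and radius. A collection $\mathcal{C}$ of (closed) balls is a Besicovitch family if for every pair of distinct balls $B^{cl}(x,r),B^{cl}(y,s)\in\mathcal{C}$, $x\notin B^{cl}(y,s)$ and $y\notin B^{cl}(x,r)$. The Besicovitch constant is $L(X,\|\cdot\|):=\sup\{\sum_{B^{cl}(x,r)\in\mathcal{C}}\mathbf{1}_{B^{cl}(x,r)}(y)\}$, the supremum being over all $y\in X$ and all Besicovitch families $\mathcal{C}$. The equal radius Besicovitch constant $E(X,\|\cdot\|)$ is defined by the same supremum, restricted to those Besicovitch families $\mathcal{C}$ all of whose balls have equal radius. *)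

(* Defs.v *)
From HB Require Import structures.
From mathcomp Require Import all_boot all_order all_algebra.
From mathcomp Require Import all_classical all_reals all_analysis.

Set Implicit Arguments.
Unset Strict Implicit.
Unset Printing Implicit Defensive.

Import Order.TTheory GRing.Theory Num.Theory.
Import numFieldNormedType.Exports.

Local Open Scope classical_set_scope.
Local Open Scope ring_scope.

Section besicovitch.
Context {R : realType} {X : normedModType R}.

(* A ball comes with a chosen center and radius, so it is represented by the
   pair b = (x, r), and a collection of balls is a set of such pairs. *)
Definition cball (b : X * R) : set X :=
  closed_ball_ (fun x : X => `|x|) b.1 b.2.

Definition Besicovitch_family (C : set (X * R)) : Prop :=
  (forall b, C b -> 0 < b.2) /\
  (forall b c, C b -> C c -> b <> c -> ~ cball c b.1 /\ ~ cball b c.1).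

Definition equal_radius (C : set (X * R)) : Prop :=
  forall b c, C b -> C c -> b.2 = c.2.

(* Number of balls of the (possibly infinite) collection C that contain y. *)
Definition multiplicity (C : set (X * R)) (y : X) : \bar R :=
  \esum_(b in C) (\1_(cball b) y)%:E.

End besicovitch.

Definition Besicovitch_constant {R : realType} (X : normedModType R) : \bar R :=
  ereal_sup [set multiplicity C y |
    C in [set C : set (X * R) | Besicovitch_family C] & y in [set: X]].

Definition equal_radius_Besicovitch_constant {R : realType}
    (X : normedModType R) : \bar R :=
  ereal_sup [set multiplicity C y |
    C in [set C : set (X * R) | Besicovitch_family C /\ equal_radius C]
    & y in [set: X]].

Lemma equal_radius_Besicovitch_constant_ge1 {R : realType}
    (X : normedModType R) : (1 <= equal_radius_Besicovitch_constant X)%E.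
Proof.
apply: ereal_sup_ubound.
exists [set (0 : X, 1 : R)]; last exists (0 : X) => //.
  split; first by split=> [b -> //|b c -> -> []].
  by move=> b c -> ->.
rewrite /multiplicity esum_set1 ?lee_fin ?indicE //.
by rewrite mem_set // /cball /closed_ball_ /= subrr normr0.
Qed.

(* Main.v *)
(** Translate the common point [y] to the origin and replace each ball
    [B(x, r)] containing it by the unit ball centred at [x / |x|].  If
    [|v| <= |u| < |u - v|], then
    [|u - v| <= |v| * |u / |u| - v / |v|| + (|u| - |v|)],
    so the normalized centres are at distance greater than [1]: the new balls
    form a Besicovitch family, all contain [0], and distinct balls stay
    distinct. *)
Require Import Defs.
From mathcomp Require Import all_boot all_order all_algebra.
From mathcomp Require Import all_classical all_reals all_analysis.
From mathcomp Require Import lra.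

Set Implicit Arguments.
Unset Strict Implicit.
Unset Printing Implicit Defensive.

Import Order.TTheory GRing.Theory Num.Theory.
Import numFieldNormedType.Exports.

Local Open Scope classical_set_scope.
Local Open Scope ring_scope.

Section normalization.
Context {R : realType} {X : normedModType R}.
Implicit Types (u v y : X) (C : set (X * R)).

(* Since [0^-1 = 0], [normalize 0 = 0]; this covers a ball centred at the
   common point. *)
Definition normalize u : X := `|u|^-1 *: u.

Lemma norm_normalize_le1 u : `|normalize u| <= 1.
Proof.
rewrite normrZ ger0_norm ?invr_ge0//.
by have [->|u0] := eqVneq `|u| 0; rewrite ?mulr0// mulVf.
Qed.

Lemma normalizeK u : `|u| *: normalize u = u.
Proof.
have [->|u0] := eqVneq u 0; first by rewrite normr0 scale0r.
by rewrite scalerA mulfV ?normr_eq0// scale1r.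
Qed.

Lemma normalize_dist_gt1_le u v :
  `|v| <= `|u| -> `|u| < `|u - v| -> 1 < `|normalize u - normalize v|.
Proof.
move=> vu uv.
have v0 : 0 < `|v|.
  by rewrite normr_gt0; apply: contraTneq uv => ->; rewrite subr0 ltxx.
(* Cutting [u] at length |v| gives both unit directions the coefficient |v|; the rest of [u] has
   length |u| - |v|. *)
have E : u - v = `|v| *: (normalize u - normalize v)
                 + (`|u| - `|v|) *: normalize u.
  by rewrite scalerBr scalerBl !normalizeK [RHS]addrC addrA subrK.
have : `|u - v| <= `|v| * `|normalize u - normalize v| + (`|u| - `|v|).
  rewrite {1}E (le_trans (ler_normD _ _))// normrZ normr_id lerD2l normrZ.
  rewrite ger0_norm ?subr_ge0// ler_piMr ?subr_ge0//.
  exact: norm_normalize_le1.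
move=> h; rewrite -(ltr_pM2l v0); lra.
Qed.

Lemma normalize_dist_gt1 u v : `|u| < `|u - v| -> `|v| < `|u - v| ->
  1 < `|normalize u - normalize v|.
Proof.
have [vu uv _|/ltW uv _] := leP `|v| `|u|; first exact: normalize_dist_gt1_le.
by rewrite distrC [X in _ -> _ < X]distrC; exact: normalize_dist_gt1_le.
Qed.

Definition unit_ball_at y (b : X * R) : X * R := (normalize (b.1 - y), 1).

(** Since [y] lies in [b] and [c] lies outside it, |b.1 - y| <= b.2 < |b.1 - c.1|, and likewise for
    [c]: the centres relative to [y] satisfy [normalize_dist_gt1]. *)
Lemma unit_ball_at_dist C y b c : Besicovitch_family C -> C b -> C c ->
  cball b y -> cball c y -> b <> c ->
  1 < `|(unit_ball_at y b).1 - (unit_ball_at y c).1|.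
Proof.
move=> [_ CB] Cb Cc; rewrite /cball/= => yb yc /(CB _ _ Cb Cc).
rewrite /cball /closed_ball_ /= => -[/negP cb /negP bc].
have E : b.1 - y - (c.1 - y) = b.1 - c.1 by rewrite opprB addrA subrK.
apply: normalize_dist_gt1; rewrite E.
- by rewrite (le_lt_trans yb)// ltNge.
- by rewrite [ltRHS]distrC (le_lt_trans yc)// ltNge.
Qed.

Lemma Besicovitch_family_unit_balls C y : Besicovitch_family C ->
  Besicovitch_family (unit_ball_at y @` (C `&` [set b | cball b y])).
Proof.
move=> CB; split=> [_ [b _ <-]//|_ _ [b [Cb yb] <-] [c [Cc yc] <-] bc].
have {}bc : b <> c by move=> e; apply: bc; rewrite e.
have := unit_ball_at_dist CB Cb Cc yb yc bc.
rewrite /cball /closed_ball_ /= => d.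
by split; apply/negP; rewrite -ltNge// distrC.
Qed.

Lemma multiplicity_unit_balls C y : Besicovitch_family C ->
  multiplicity (unit_ball_at y @` (C `&` [set b | cball b y])) 0
  = multiplicity C y.
Proof.
move=> CB; rewrite /multiplicity.
(* Equal images would have centres at distance 0, not above 1, so no balls merge. *)
have inj : {in C `&` [set b | cball b y] &, injective (unit_ball_at y)}.
  move=> b c /set_mem[Cb yb] /set_mem[Cc yc] bc; apply: contrapT => nbc.
  have := unit_ball_at_dist CB Cb Cc yb yc nbc.
  by rewrite bc subrr normr0 ltr10.
rewrite (reindex_esum _ _ _ _ (inj_bij inj)).
(* Summing over all of [C], the condition that [b] contains [y] becomes the indicator: each new ball
   counts 1 at the origin. *)
rewrite esum_mkcondr; apply: eq_esum => b Cb.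
have z : cball (unit_ball_at y b) 0.
  by rewrite /cball /closed_ball_ /= subr0 norm_normalize_le1.
rewrite !indicE (mem_set z); have [yb|yb] := boolP (y \in cball b).
  by rewrite mem_set//=; exact: set_mem.
by rewrite memNset//= => /mem_set; exact/negP.
Qed.

End normalization.

Theorem theorem3p1 (R : realType) (X : completeNormedModType R)
    (hX : exists x y : X, x <> y) :
  equal_radius_Besicovitch_constant X = Besicovitch_constant X.
Proof.
apply/eqP; rewrite eq_le; apply/andP; split.
  by apply: ereal_sup_le => _ [C [CB _]] [y _ <-]; exists C => //; exists y.
(* Each multiplicity of [C] at [y] is attained at the origin by a family of unit balls. *)
apply: ge_ereal_sup => _ [C CB] [y _ <-]; apply: ereal_sup_ubound.
exists (unit_ball_at y @` (C `&` [set b | cball b y])); last first.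
  by exists 0 => //; exact: multiplicity_unit_balls.
by split; [exact: Besicovitch_family_unit_balls|move=> _ _ [b _ <-] [c _ <-]].
Qed.
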